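(* Let $V$ be a vector space over a field, let $W$ be a subspace of $V$, and let $\mathbb{S}(W)$ be a subsemigroup of $L(W)$. Then $L_{\mathbb{S}(W)}(V)$ is an inverse semigroup if and only if both of the following hold: (i) $\mathbb{S}(W)$ is an inverse semigroup; (ii) either $W=V$ or $\dim(V)=1$.
   Context: Semigroups (hence subsemigroups) are nonempty. For a vector space $U$, $L(U)$ is the semigroup of all linear maps $U\to U$ under composition (composed from left to right, with $vf$ denoting the image of $v$ under $f$). For $f\in L(V)$ with $Wf\subseteq W$, $f_{\upharpoonright_W}\in L(W)$ denotes the linear map $W\to W$ that agrees with $f$ on $W$. Define $L_{\mathbb{S}(W)}(V)=\{f\in L(V) : Wf\subseteq W \text{ and } f_{\upharpoonright_W}\in\mathbb{S}(W)\}$, a subsemigroup of $L(V)$. A semigroup $S$ is an inverse semigroup if for every $x\in S$ there is a unique $y\in S$ with $xyx=x$ and $yxy=y$. *)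

(* Defs.v *)
From HB Require Import structures.
From mathcomp Require Import all_boot all_order all_algebra.
From mathcomp Require Import boolp classical_sets.

Set Implicit Arguments.
Unset Strict Implicit.
Unset Printing Implicit Defensive.

Import GRing.Theory.

Local Open Scope ring_scope.
Local Open Scope classical_set_scope.

Section Semigroups.
Variable G : semigroupType.
Local Open Scope group_scope.

Definition is_subsemigroup (S : set G) : Prop :=
  S !=set0 /\ forall x y, S x -> S y -> S (x * y).

Definition is_inverse_semigroup (S : set G) : Prop :=
  is_subsemigroup S /\
  forall x, S x -> exists! y, S y /\ x * y * x = x /\ y * x * y = y.

End Semigroups.

Section Dimension.
Variables (K : fieldType) (V : lmodType K).

Definition is_basis n (b : 'I_n -> V) : Prop :=
  (forall c : 'I_n -> K, \sum_(i < n) c i *: b i = 0 -> forall i, c i = 0) /\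
  (forall v : V, exists c : 'I_n -> K, v = \sum_(i < n) c i *: b i).

(* [V] itself may be infinite-dimensional, in which case [has_dim n] fails for
   every [n]; hence [vectType] and [\dim] are not usable here. *)
Definition has_dim n : Prop := exists b : 'I_n -> V, is_basis b.

End Dimension.

Section LinearMaps.
Variables (K : fieldType) (U : lmodType K).

Definition lmaps : Type := {linear U -> U}.

Definition lmaps_fun (f : lmaps) : {linear U -> U} := f.
Coercion lmaps_fun : lmaps >-> GRing.Linear.type.

HB.instance Definition _ := gen_eqMixin lmaps.
HB.instance Definition _ := gen_choiceMixin lmaps.

Lemma lmaps_ext (f g : lmaps) : f =1 g -> f = g.
Proof.
move=> fg; have {fg} : (f : U -> U) = g by apply: funext.
rewrite /lmaps_fun; case: f g => [f [[f0] [f1]]] [g [[g0] [g1]]] /= fg.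
move: f0 f1 g0 g1; rewrite {}fg => f0 f1 g0 g1.
by rewrite (Prop_irrelevance f0 g0) (Prop_irrelevance f1 g1).
Qed.

(* Composition from left to right: [v (f g) = (v f) g]. *)
Definition lmaps_mul (f g : lmaps) : lmaps :=
  (g \o f : {linear U -> U}).

Lemma lmaps_mulA : associative lmaps_mul.
Proof. by move=> f g h; apply: lmaps_ext. Qed.

HB.instance Definition _ := isSemigroup.Build lmaps lmaps_mulA.

Lemma lmaps_mulE (f g : lmaps) (v : U) : (f * g)%g v = g (f v).
Proof. by []. Qed.

End LinearMaps.

Section Subspace.
Variables (K : fieldType) (V : lmodType K) (W : submodClosed V).

Definition subspace : Type := {v : V | v \in W}.

HB.instance Definition _ := SubChoice.on subspace.
HB.instance Definition _ := [SubChoice_isSubLmodule of subspace by <:].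

Definition stabilizes (f : lmaps V) : Prop := forall w, w \in W -> f w \in W.

Section Restriction.
Variables (f : lmaps V) (fW : stabilizes f).

Definition restrict_fun (w : subspace) : subspace :=
  exist _ (f (val w)) (fW (valP w)).

Lemma restrict_is_linear : linear restrict_fun.
Proof. by move=> a u v; apply: val_inj; rewrite /= linearP. Qed.

HB.instance Definition _ :=
  GRing.isLinear.Build K subspace subspace _ restrict_fun restrict_is_linear.

Definition restrict : lmaps subspace :=
  (restrict_fun : {linear subspace -> subspace}).

Lemma val_restrict (w : subspace) : val (restrict w) = f (val w).
Proof. by []. Qed.

End Restriction.

Definition lmaps_restricting_to (S : set (lmaps subspace)) : set (lmaps V) :=
  [set f | exists fW : stabilizes f, S (restrict fW)].

End Subspace.

(* Main.v *)
(* Fix a projection [p] of [V] onto [W] (Zorn).  Extending [s] in [S(W)] by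
   [p s] embeds [S(W)] in [L_S(W)(V)], so [S(W)] inherits inverses and their
   uniqueness.  If [W <> V], pick a linear functional [phi] vanishing on [W] with
   [phi u = 1].  For an idempotent [e] of [S(W)] and [w] in [W], the maps [p e]
   and [v |-> v p e + phi(v) w e] are both inverses of [p e], so [w e = 0]; hence
   [S(W) = {0}].  Then the rank-one idempotents [v |-> phi(v) x], for
   [phi x = 1], are inverse to each other, hence all equal, which forces
   [ker phi = 0]. *)
Require Import Defs.
From HB Require Import structures.
From mathcomp Require Import all_boot all_order all_algebra.
From mathcomp Require Import boolp classical_sets.

Set Implicit Arguments.
Unset Strict Implicit.
Unset Printing Implicit Defensive.

Import GRing.Theory.

Local Open Scope ring_scope.
Local Open Scope classical_set_scope.

(** * Idempotents in an inverse semigroup *)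

Section InverseSemigroup.
Variable G : semigroupType.
Local Open Scope group_scope.

Lemma is_inverse_semigroup_left_unit (S : set G) x :
  is_inverse_semigroup S -> S x -> exists e, [/\ S e, e * e = e & e * x = x].
Proof.
move=> [[_ SM] Sinv] Sx; have [y [[Sy [xyx _]] _]] := Sinv x Sx.
by exists (x * y); split=> //; [exact: SM | rewrite mulgA xyx].
Qed.

(** An idempotent is its own inverse, so uniqueness leaves no other. *)
Lemma is_inverse_semigroup_idem_inv (S : set G) e f :
  is_inverse_semigroup S -> S e -> S f ->
  e * e = e -> e * f * e = e -> f * e * f = f -> e = f.
Proof.
move=> [_ Sinv] Se Sf ee efe fef; have [y [_ yuniq]] := Sinv e Se.
by rewrite -(yuniq f) // -(yuniq e) // !ee.
Qed.

End InverseSemigroup.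

(** * Complements, projections and functionals in arbitrary dimension *)

Section Complement.
Variables (K : fieldType) (V : lmodType K).

(** A bare condition on sets, stable under unions of chains. The empty set satisfies it, so
    membership of [0] is handled apart. *)
Definition lincomb_closed (A : set V) : Prop :=
  forall (a : K) u v, A u -> A v -> A (a *: u + v).

(** Zorn's lemma gives a maximal closed [C] meeting [A] at most in [0]; a vector outside [A + C]
    could be adjoined to [C]. *)
Lemma lincomb_closed_complement (A : set V) : A 0 -> lincomb_closed A ->
  exists C : set V, [/\ C 0, lincomb_closed C,
    forall v, A v -> C v -> v = 0
    & forall v, exists x y, [/\ A x, C y & v = x + y]].
Proof.
move=> A0 Alin.
pose P (C : set V) := lincomb_closed C /\ forall v, A v -> C v -> v = 0.
have [F FP Ftot|C [[Clin CA] Cmax]] := @Zorn_bigcup V P.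
  split=> [a u v [X FX Xu] [Y FY Yv]|v Av [X FX Xv]]; last first.
    by have [_] := FP X FX; apply.
  have [XY|YX] := Ftot X Y FX FY.
  - by exists Y => //; have [+ _] := FP Y FY; apply=> //; apply: XY.
  - by exists X => //; have [+ _] := FP X FX; apply=> //; apply: YX.
(* Otherwise adjoining [0] to [C] would contradict maximality. *)
have C0 : C 0.
  have [//|nC0] := pselect (C 0).
  suff CE : P [set x | x = 0 \/ C x].
    exfalso; apply: (Cmax _ _ CE); split=> [|CC]; last by apply/nC0/CC; left.
    by move=> x Cx; right.
  split=> [a u v|v Av [//|/CA]]; last by apply.
  move=> [->|Cu] [->|Cv]; rewrite ?scaler0 ?addr0 ?add0r; first by left.
  - by right.
  (* Closure must be used without [0], which is not yet known to lie in [C]. *)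
  - right; have -> : a *: u = (a - 1) *: u + u by rewrite scalerBl scale1r subrK.
    exact: Clin.
  - by right; apply: Clin.
exists C; split=> // v.
have [//|nv] := pselect (exists x y, [/\ A x, C y & v = x + y]).
exfalso.
pose D : set V := [set x | exists k c, C c /\ x = k *: v + c].
apply: (Cmax D).
  split=> [c Cc|DC]; first by exists 0, c; rewrite scale0r add0r.
  apply: nv; exists 0, v; rewrite add0r; split=> //; apply: DC.
  by exists 1, 0; rewrite scale1r addr0.
split=> [a _ _ [k [c [Cc ->]]] [l [d [Cd ->]]]|x Ax [k [c [Cc xE]]]].
  exists (a * k + l), (a *: c + d); split; first exact: Clin.
  by rewrite scalerDr scalerA scalerDl addrACA.
have [k0|k0] := eqVneq k 0.
  by apply: CA => //; rewrite xE k0 scale0r add0r.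
(* Solving [x = k *: v + c] for [v] puts [v] in [A + C]. The summands [0] give both terms the shape
   required by closure. *)
exfalso; apply: nv; exists (k^-1 *: x + 0), ((- k^-1) *: c + 0); split.
- exact: Alin.
- exact: Clin.
- by rewrite xE !addr0 scalerDr scalerA mulVf // scale1r scaleNr addrK.
Qed.

Lemma scale_vector_inj (u : V) : u != 0 -> injective (fun a : K => a *: u).
Proof.
move=> u0 a b /eqP.
by rewrite -subr_eq0 -scalerBl scaler_eq0 (negPf u0) orbF subr_eq0 => /eqP.
Qed.

Lemma linear_lmaps (U : lmodType K) (f : U -> U) : linear f ->
  exists g : lmaps U, forall v, g v = f v.
Proof.
move=> flin; pose fL := GRing.isLinear.Build K U U _ f flin.
by exists (HB.pack f fL : {linear U -> U}).
Qed.

(** The component of [v] in [A] is unique because [A] meets its complement only in [0]; linearity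
    follows from this uniqueness. *)
Lemma lincomb_closed_projection (A : set V) : A 0 -> lincomb_closed A ->
  exists p : lmaps V, (forall v, A (p v)) /\ (forall v, A v -> p v = v).
Proof.
move=> A0 Alin; have [C [C0 Clin AC ACV]] := lincomb_closed_complement A0 Alin.
have /choice[p pP] v : exists x, A x /\ C (v - x).
  by have [x [y [Ax Cy ->]]] := ACV v; exists x; rewrite addrC addKr.
have puniq v x : A x -> C (v - x) -> p v = x.
  move=> Ax Cvx; have [Ap Cp] := pP v; apply/eqP; rewrite -subr_eq0; apply/eqP.
  apply: AC; first by rewrite addrC -scaleN1r; apply: Alin.
  have -> : p v - x = -1 *: (v - p v) + (v - x).
    by rewrite scaleN1r opprB addrA subrK.
  exact: Clin.
have [|q qE] := @linear_lmaps V p.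
  move=> a u v; have [[Au Cu] [Av Cv]] := (pP u, pP v).
  apply: puniq; first exact: Alin.
  by rewrite opprD addrACA -scalerBr; apply: Clin.
exists q; split=> v; first by rewrite qE; have [] := pP v.
by move=> Av; rewrite qE; apply: puniq; rewrite ?subrr.
Qed.

(** The map [1 - p] kills [A] and fixes [u1 = u - p u], which is nonzero. Following it by a
    projection onto the line of [u1] and reading the coordinate there gives [phi]. *)
Lemma lincomb_closed_functional (A : set V) u : A 0 -> lincomb_closed A ->
  ~ A u -> exists phi : V -> K, [/\ scalar phi, forall v, A v -> phi v = 0
    & exists v, phi v = 1].
Proof.
move=> A0 Alin nAu; have [p [pA pid]] := lincomb_closed_projection A0 Alin.
pose u1 := u - p u.
have u1_neq0 : u1 != 0.
  by apply/eqP => /eqP; rewrite subr_eq0 => /eqP uE; apply: nAu; rewrite uE.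
have pu1 : p u1 = 0 by rewrite linearB /= (pid (p u)) ?subrr.
have [||r [rL rid]] := @lincomb_closed_projection [set v | exists k, v = k *: u1].
- by exists 0; rewrite scale0r.
- move=> a _ _ [k ->] [l ->]; exists (a * k + l).
  by rewrite scalerDl scalerA.
have /choice[phi phiE] v : exists k, r (v - p v) = k *: u1 by apply: rL.
have phi_eq v k : r (v - p v) = k *: u1 -> phi v = k.
  by rewrite phiE => /(scale_vector_inj u1_neq0).
exists phi; split.
- move=> a v w; apply: phi_eq.
  rewrite scalerDl -phiE -scalerA -phiE -linearP; congr (r _).
  by rewrite linearP opprD addrACA scalerBr.
- by move=> v Av; apply: phi_eq; rewrite pid // subrr linear0 scale0r.
- exists u1; apply: phi_eq; rewrite pu1 subr0 rid ?scale1r //.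
  by exists 1; rewrite scale1r.
Qed.

End Complement.

(** * Passing between maps of [V] and their restrictions to [W] *)

Section Restricting.
Variables (K : fieldType) (V : lmodType K) (W : submodClosed V).
Implicit Types (f g : lmaps V) (s t : lmaps (subspace W)).

(** Relates [f] to its restriction without carrying a proof that [f] stabilizes [W], which the
    relation implies. *)
Definition extends f s : Prop := forall w : subspace W, f (val w) = val (s w).

Lemma lmaps_restricting_toP (S : set (lmaps (subspace W))) f :
  lmaps_restricting_to S f <-> exists2 s, S s & extends f s.
Proof.
split=> [[fW SfW]|[s Ss fs]]; first by exists (restrict fW).
have fW : stabilizes W f by move=> w Ww; have /= -> := fs (Sub w Ww); apply: valP.
exists fW; suff -> : restrict fW = s by [].
by apply: lmaps_ext => w; apply: val_inj; rewrite val_restrict fs.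
Qed.

Lemma extendsM f g s t :
  extends f s -> extends g t -> extends (f * g)%g (s * t)%g.
Proof. by move=> fs gt w; rewrite !lmaps_mulE fs gt. Qed.

Lemma extends_sandwich f g s t :
  extends f s -> extends g t -> extends (f * g * f)%g (s * t * s)%g.
Proof. by move=> fs gt; apply: extendsM => //; apply: extendsM. Qed.

Lemma extends_inj f s t : extends f s -> extends f t -> s = t.
Proof. by move=> fs ft; apply: lmaps_ext => w; apply: val_inj; rewrite -fs ft. Qed.

Lemma extends_full f g s : (forall v, v \in W) ->
  extends f s -> extends g s -> f = g.
Proof.
move=> WT fs gs; apply: lmaps_ext => v.
by have := fs (Sub v (WT v)); rewrite -gs.
Qed.

Lemma submod_lincomb_closed : lincomb_closed [set v : V | v \in W].
Proof. by move=> a u v /= Wu Wv; rewrite rpredD ?rpredZ. Qed.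

(* [E] is multiplicative because [E s] vanishes on the kernel of one fixed
   projection onto [W], independent of [s]. *)
Lemma multiplicative_extension : exists E : lmaps (subspace W) -> lmaps V,
  [/\ forall s, extends (E s) s, forall s v, E s v \in W
    & forall s t, E (s * t)%g = (E s * E t)%g].
Proof.
have [||p [pW pid]] := @lincomb_closed_projection K V [set v | v \in W].
- exact: rpred0.
- exact: submod_lincomb_closed.
pose q v : subspace W := Sub (p v) (pW v).
have qlin : linear q by move=> a u v; apply: val_inj; rewrite /= linearP.
have qid (w : subspace W) : q (val w) = w.
  by apply: val_inj; rewrite /= pid //; apply: valP.
have /choice[E EE] s : exists f : lmaps V, forall v, f v = val (s (q v)).
  by apply: linear_lmaps => a u v; rewrite qlin !linearP.
exists E; split=> [s w|s v|s t]; rewrite ?EE ?qid //; first exact: valP.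
by apply: lmaps_ext => v; rewrite lmaps_mulE !EE qid.
Qed.

Lemma lmaps_restricting_to_subsemigroup (S : set (lmaps (subspace W))) :
  is_subsemigroup S -> is_subsemigroup (lmaps_restricting_to S).
Proof.
move=> [[s Ss] SM]; have [E [Eext _ _]] := multiplicative_extension.
split; first by exists (E s); apply/lmaps_restricting_toP; exists s.
move=> f g /lmaps_restricting_toP[t St ft] /lmaps_restricting_toP[u Su gu].
apply/lmaps_restricting_toP; exists (t * u)%g; first exact: SM.
exact: extendsM.
Qed.

(** Existence comes by restricting the inverse [g] of [E s]. Uniqueness comes by lifting: if [u] is
    an inverse of [s], then [E u] is one of [E s], so it equals [g]. *)
Lemma is_inverse_semigroup_restriction (S : set (lmaps (subspace W))) :
  is_subsemigroup S -> is_inverse_semigroup (lmaps_restricting_to S) ->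
  is_inverse_semigroup S.
Proof.
move=> Ssub [_ Linv]; have [E [Eext _ EM]] := multiplicative_extension.
have LE s : S s -> lmaps_restricting_to S (E s).
  by move=> Ss; apply/lmaps_restricting_toP; exists s.
split=> // s Ss; have [g [[Lg [sgs gsg]] guniq]] := Linv _ (LE s Ss).
have /lmaps_restricting_toP[t St gt] := Lg.
exists t; split.
  split=> //; split; [apply: (@extends_inj (E s)) | apply: (@extends_inj g)] => //.
  - by rewrite -{1}sgs; apply: extends_sandwich.
  - by rewrite -{1}gsg; apply: extends_sandwich.
have Euniq u : S u /\ (s * u * s = s /\ u * s * u = u)%g -> g = E u.
  move=> [Su [sus usu]]; apply: guniq; split; first exact: LE.
  by rewrite -!EM sus usu.
move=> u /Euniq gE; apply: (@extends_inj g) => //; rewrite gE; exact: Eext.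
Qed.

(** When [W] is everything, a map is determined by its restriction, so inverse equations can be
    checked on restrictions. *)
Lemma is_inverse_semigroup_full (S : set (lmaps (subspace W))) :
  (forall v, v \in W) -> is_inverse_semigroup S ->
  is_inverse_semigroup (lmaps_restricting_to S).
Proof.
move=> WT [Ssub Sinv]; have [E [Eext _ _]] := multiplicative_extension.
split=> [|f /lmaps_restricting_toP[s Ss fs]].
  exact: lmaps_restricting_to_subsemigroup.
have [t [[St [sts tst]] tuniq]] := Sinv s Ss.
exists (E t); split.
  split; first by apply/lmaps_restricting_toP; exists t.
  split; [apply: (@extends_full _ _ s) | apply: (@extends_full _ _ t)] => //.
  - by rewrite -sts; apply: extends_sandwich.
  - by rewrite -[X in extends _ X]tst; apply: extends_sandwich.
move=> g [/lmaps_restricting_toP[u Su gu] [fgf gfg]].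
suff tu : t = u by apply: (@extends_full _ _ t) => //; rewrite tu.
apply: tuniq; split=> //; split.
- by apply: (@extends_inj f) => //; rewrite -fgf; apply: extends_sandwich.
- by apply: (@extends_inj g) => //; rewrite -gfg; apply: extends_sandwich.
Qed.

End Restricting.

(** * Linear maps of a line *)

Section OneDimensional.
Variables (K : fieldType) (V : lmodType K).

Lemma has_dim1P : has_dim V 1 <->
  exists2 b : V, b != 0 & forall v, exists c : K, v = c *: b.
Proof.
split=> [[b [bfree bgen]]|[b b0 bgen]].
  exists (b ord0) => [|v]; last first.
    by have [c ->] := bgen v; exists (c ord0); rewrite big_ord1.
  apply/eqP => b0; have := bfree (fun=> 1) _ ord0.
  rewrite big_ord1 b0 scaler0 => /(_ erefl)/eqP.
  by rewrite oner_eq0.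
exists (fun=> b); split=> [c|v].
  rewrite big_ord1 => /eqP; rewrite scaler_eq0 (negPf b0) orbF => /eqP c0 i.
  by rewrite ord1.
by have [c ->] := bgen v; exists (fun=> c); rewrite big_ord1.
Qed.

(** Every linear map is a homothety, so composition is multiplication in [K]. *)
Lemma is_inverse_semigroup_lmaps_dim1 :
  has_dim V 1 -> is_inverse_semigroup [set: lmaps V].
Proof.
move=> /has_dim1P[b b0 bgen].
have scal (f : lmaps V) : exists c, forall v, f v = c *: v.
  have [c fb] := bgen (f b); exists c => v; have [d ->] := bgen v.
  by rewrite linearZ /= fb !scalerA mulrC.
have homothety c : exists f : lmaps V, forall v, f v = c *: v.
  by apply: linear_lmaps => a u v; rewrite scalerDr !scalerA mulrC.
split; first by split=> //; have [f _] := homothety 0; exists f.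
(* The convention [0^-1 = 0] makes [c^-1] the right choice for [c = 0] too. *)
move=> f _; have [c fE] := scal f; have [g gE] := homothety c^-1.
exists g; split=> [|h [_ [fhf hfh]]].
  split=> //; split; apply: lmaps_ext => v; rewrite !lmaps_mulE !fE !gE ?fE ?scalerA.
  - by have [->|c0] := eqVneq c 0; rewrite ?mul0r // -mulrA mulVf ?mulr1.
  - by have [->|c0] := eqVneq c 0; rewrite ?invr0 ?mul0r // mulVf ?mul1r.
have [d hE] := scal h.
have scalb x y : x *: b = y *: b -> x = y by apply: scale_vector_inj.
have cdc : c * (d * c) = c.
  by apply: scalb; rewrite -!scalerA -hE -!fE -!lmaps_mulE mulgA fhf.
have dcd : d * (c * d) = d.
  by apply: scalb; rewrite -!scalerA -fE -!hE -!lmaps_mulE mulgA hfh.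
apply: lmaps_ext => v; rewrite gE hE; congr (_ *: _).
have [c0|c0] := eqVneq c 0; first by rewrite -dcd c0 mul0r mulr0 invr0.
by apply: (mulfI c0); apply: (mulIf c0); rewrite mulfV // mul1r -mulrA cdc.
Qed.

End OneDimensional.

(** * The case of a proper subspace [W] *)

Section Dichotomy.
Variables (K : fieldType) (V : lmodType K) (W : submodClosed V).
Implicit Types (S : set (lmaps (subspace W))).

(** A proper subspace of a line is zero and has only one linear map, which must be the element of
    the nonempty [S]. *)
Lemma lmaps_restricting_toT S : is_subsemigroup S ->
  ~ (forall v : V, v \in W) -> has_dim V 1 -> lmaps_restricting_to S = setT.
Proof.
move=> [[s Ss] _] WNT /has_dim1P[b b0 bgen].
have W0 w : w \in W -> w = 0.
  have [c ->] := bgen w; have [->|c0] := eqVneq c 0; first by rewrite scale0r.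
  rewrite rpredZeq (negPf c0) /= => Wb; case: WNT => v.
  by have [d ->] := bgen v; apply: rpredZ.
apply/seteqP; split=> // f _; apply/lmaps_restricting_toP; exists s => // w.
by rewrite (W0 _ (valP w)) linear0 (W0 _ (valP (s w))).
Qed.

(** Since [s = e * s] for some idempotent [e] of [S], it suffices to show that [e] vanishes. *)
Lemma is_inverse_semigroup_functional_eq0 S (phi : V -> K) s :
  scalar phi -> (forall v, v \in W -> phi v = 0) -> (exists v, phi v = 1) ->
  is_inverse_semigroup S -> is_inverse_semigroup (lmaps_restricting_to S) ->
  S s -> forall w, s w = 0.
Proof.
move=> philin phiW [u phiu] Sinv Linv Ss w.
have [e [Se ee es]] := is_inverse_semigroup_left_unit Sinv Ss.
rewrite -es lmaps_mulE; suff -> : e w = 0 by rewrite linear0.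
have [E [Eext EW EM]] := multiplicative_extension W.
(* The added rank-one term vanishes on [W], so [f] also restricts to [e]; its values are multiples
   of a vector fixed by [E e], so [f] is an inverse of [E e]. *)
have [|f fE] := @linear_lmaps K V (fun v => E e v + phi v *: val (e w)).
  move=> a x y; rewrite linearP philin scalerDl -scalerA addrACA.
  by rewrite scalerDr.
have EE v : E e (E e v) = E e v by rewrite -lmaps_mulE -EM ee.
have eew : E e (val (e w)) = val (e w) by rewrite Eext -lmaps_mulE ee.
have Ef : E e = f.
  apply: (is_inverse_semigroup_idem_inv Linv).
  - by apply/lmaps_restricting_toP; exists e.
  - apply/lmaps_restricting_toP; exists e => // x.
    by rewrite fE phiW ?scale0r ?addr0 ?Eext //; apply: valP.
  - by rewrite -EM ee.
  - by apply: lmaps_ext => v; rewrite !lmaps_mulE fE phiW // scale0r addr0 !EE.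
  - apply: lmaps_ext => v; rewrite !lmaps_mulE !fE (phiW (E e _)) // scale0r.
    by rewrite addr0 !linearD !linearZ /= !EE eew.
(* At [u], where [phi] is [1], the equality [E e = f] says that the added term [e w] is zero. *)
apply: val_inj; have := fE u; rewrite -Ef phiu scale1r => /eqP.
by rewrite -[X in X == _]addr0 (inj_eq (addrI _)) eq_sym => /eqP.
Qed.

Lemma is_inverse_semigroup_dim1 S : is_inverse_semigroup S ->
  is_inverse_semigroup (lmaps_restricting_to S) ->
  ~ (forall v : V, v \in W) -> has_dim V 1.
Proof.
move=> Sinv Linv /existsNP[v0 Wv0].
have [||phi [philin phiW [u phiu]]] :=
  @lincomb_closed_functional K V [set v | v \in W] v0 _ _ Wv0.
- exact: rpred0.
- exact: submod_lincomb_closed.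
have [[s Ss] _] := Sinv.1.
have s0 := is_inverse_semigroup_functional_eq0 philin phiW
  (ex_intro _ u phiu) Sinv Linv Ss.
have proj x : exists f : lmaps V, forall v, f v = phi v *: x.
  by apply: linear_lmaps => a y z; rewrite philin scalerDl scalerA.
(* These maps vanish on [W], hence restrict to [s], which is zero. *)
have Lproj (f : lmaps V) x : (forall v, f v = phi v *: x) ->
    lmaps_restricting_to S f.
  move=> fE; apply/lmaps_restricting_toP; exists s => // w.
  by rewrite s0 fE phiW ?scale0r //; apply: valP.
have phiZ a v : phi (a *: v) = a * phi v.
  have phi0 : phi 0 = 0 by apply/phiW/rpred0.
  by rewrite -[a *: v]addr0 philin phi0 addr0.
(* The idempotents with images spanned by [u] and [x] share the kernel of [phi], so they are
   mutually inverse, hence equal; evaluate at [u]. *)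
have phi1_uniq x : phi x = 1 -> u = x.
  move=> phix; have [[f fE] [g gE]] := (proj u, proj x).
  rewrite -[u]scale1r -[x in RHS]scale1r -phiu -fE -gE.
  congr (lmaps_fun _ u).
  apply: (is_inverse_semigroup_idem_inv Linv (Lproj _ _ fE) (Lproj _ _ gE));
    by apply: lmaps_ext => v; rewrite !lmaps_mulE !(fE, gE) !phiZ ?phiu ?phix !mulr1.
apply/has_dim1P; exists u => [|v].
  apply/eqP => u0; have phi0 : phi u = 0 by rewrite u0; apply/phiW/rpred0.
  by have := oner_neq0 K; rewrite -phiu phi0 eqxx.
(* Shifting [v] along [u] to level [phi = 1] gives [u] itself, so [v] is [phi v *: u]. *)
have uE : u = (1 - phi v) *: u + v.
  by apply: phi1_uniq; rewrite philin phiu mulr1 subrK.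
exists (phi v); apply: (addrI ((1 - phi v) *: u)).
by rewrite -uE -scalerDl subrK scale1r.
Qed.

End Dichotomy.

Theorem theorem4p9 (K : fieldType) (V : lmodType K) (W : submodClosed V)
    (SW : set (lmaps (subspace W))) (hSW : is_subsemigroup SW) :
  is_inverse_semigroup (lmaps_restricting_to SW) <->
  is_inverse_semigroup SW /\
  ((forall v : V, v \in W) \/ has_dim V 1).
Proof.
split=> [Linv|[Sinv Wdim]].
  have Sinv := is_inverse_semigroup_restriction hSW Linv; split=> //.
  have [WT|WNT] := pselect (forall v, v \in W); first by left.
  by right; exact: is_inverse_semigroup_dim1 Sinv Linv WNT.
have [WT|WNT] := pselect (forall v, v \in W).
  exact: is_inverse_semigroup_full.
(* For a proper [W] in a line, the semigroup is all of [L(V)]. *)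
case: Wdim => // dimV; rewrite lmaps_restricting_toT //.
exact: is_inverse_semigroup_lmaps_dim1.
Qed.
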